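(* Let $\{d_n\}_1^\infty$ be a sequence of positive numbers, $c>0$, $\nu(x)=\frac{cx}{\sqrt{1+c^2x^2}}$, and let $\beta=\{\beta_n\}_1^\infty\subset\mathbb C^{p\times p}$ be a sequence of selfadjoint matrices. Let $\mathbf J_{X,\beta}$ be the minimal Jacobi operator in $l^2(\mathbb N_0;\mathbb C^p)$ associated with the block Jacobi matrix whose diagonal entries are $\mathcal A_{2j}=\mathbb O_p$, $\mathcal A_{2j+1}=-\frac{\nu^2(d_{j+1})}{d_{j+1}^3}(\beta_{j+1}+d_{j+1}\mathbb I_p)$ and whose off-diagonal entries are $\mathcal B_{2j}=\frac{\nu(d_{j+1})}{d_{j+1}^2}\mathbb I_p$, $\mathcal B_{2j+1}=\frac{\nu(d_{j+1})}{d_{j+1}^{3/2}d_{j+2}^{1/2}}\mathbb I_p$, $j\in\mathbb N_0$. If $$\sum_{n=2}^\infty d_n\prod_{k=1}^{n-1}\big(1+c\|\beta_k\|_{\mathbb C^{p\times p}}\big)^2<+\infty ,$$ then the deficiency indices of $\mathbf J_{X,\beta}$ are maximal, i.e. $n_\pm(\mathbf J_{X,\beta})=p$.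
   Context: Here $d_n=x_n-x_{n-1}$ for a strictly increasing sequence $X=\{x_n\}_{n\ge0}$ with $x_0=0$. A block Jacobi matrix with entries $\mathcal A_n=\mathcal A_n^*$, $\mathcal B_n$ (invertible) in $\mathbb C^{p\times p}$, $n\in\mathbb N_0$, acts by $(\mathbf Jf)_n=\mathcal B_{n-1}^*f_{n-1}+\mathcal A_nf_n+\mathcal B_nf_{n+1}$ (with the term containing $f_{-1}$ omitted for $n=0$); the minimal operator is the closure in $l^2(\mathbb N_0;\mathbb C^p)$ of this map restricted to finitely supported sequences. Deficiency indices: $n_\pm(\mathbf J)=\dim\ker(\mathbf J^*\mp iI)$. $\mathbb I_p,\mathbb O_p$ are the identity and zero $p\times p$ matrices; matrix norms are operator norms. *)

(* Defs.v *)
From mathcomp Require Import all_boot all_order all_algebra.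
From mathcomp Require Import all_classical reals ereal topology normedtype.
From mathcomp Require Import sequences exp.
From mathcomp Require Import complex.

Set Implicit Arguments.
Unset Strict Implicit.
Unset Printing Implicit Defensive.

Import Order.TTheory GRing.Theory Num.Theory.
Import numFieldNormedType.Exports.

Local Open Scope classical_set_scope.
Local Open Scope ring_scope.
Local Open Scope sesquilinear_scope.

(* Square-summable sequences are carved out of all vector sequences by the
   predicate [l2]; an operator in l^2 is represented by its graph, a set of
   pairs of sequences. *)
Definition cseq (R : realType) (p : nat) := nat -> 'cV[R[i]]_p.

Definition vdot (R : realType) (p : nat) (u v : 'cV[R[i]]_p) : R[i] :=
  \sum_(k < p) u k 0 * (v k 0)^*.

Definition vnorm (R : realType) (p : nat) (u : 'cV[R[i]]_p) : R :=
  Num.sqrt (\sum_(k < p) Normc.normc (u k 0) ^+ 2).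

Definition opnorm (R : realType) (p : nat) (M : 'M[R[i]]_p) : R :=
  sup [set vnorm (M *m v) | v in [set v : 'cV[R[i]]_p | vnorm v <= 1]].

Definition l2 (R : realType) (p : nat) : set (cseq R p) :=
  [set f | cvgn (series (fun n => vnorm (f n) ^+ 2))].

Definition l2norm (R : realType) (p : nat) (f : cseq R p) : R :=
  Num.sqrt (limn (series (fun n => vnorm (f n) ^+ 2))).

(* The regular module [R[i]^o] carries the topology of the complex numbers. *)
Definition l2dot (R : realType) (p : nat) (f g : cseq R p) : R[i] :=
  limn (series (fun n => vdot (f n) (g n) : R[i]^o)).

Definition fin_supp (R : realType) (p : nat) (f : cseq R p) : Prop :=
  exists N : nat, forall n, (N <= n)%N -> f n = 0.

Definition jacobi_map (R : realType) (p : nat) (A B : nat -> 'M[R[i]]_p)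
    (f : cseq R p) : cseq R p :=
  fun n => (if n is m.+1 then (B m)^t* *m f m else 0)
           + A n *m f n + B n *m f n.+1.

Definition pre_jacobi (R : realType) (p : nat) (A B : nat -> 'M[R[i]]_p)
    : set (cseq R p * cseq R p) :=
  [set fh | fin_supp fh.1 /\ fh.2 = jacobi_map A B fh.1].

Definition op_closure (R : realType) (p : nat)
    (T : set (cseq R p * cseq R p)) : set (cseq R p * cseq R p) :=
  [set fh | [/\ l2 fh.1, l2 fh.2 &
     forall e : R, 0 < e -> exists2 gk, T gk &
       [/\ l2 gk.1, l2 gk.2,
           l2norm (fun n => fh.1 n - gk.1 n) < e &
           l2norm (fun n => fh.2 n - gk.2 n) < e]]].

Definition min_jacobi (R : realType) (p : nat) (A B : nat -> 'M[R[i]]_p)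
    : set (cseq R p * cseq R p) :=
  op_closure (pre_jacobi A B).

Definition op_adjoint (R : realType) (p : nat)
    (T : set (cseq R p * cseq R p)) : set (cseq R p * cseq R p) :=
  [set gh | [/\ l2 gh.1, l2 gh.2 &
     forall fk, T fk -> l2dot fk.2 gh.1 = l2dot fk.1 gh.2]].

(* ker (T - z I) *)
Definition ker_shift (R : realType) (p : nat)
    (T : set (cseq R p * cseq R p)) (z : R[i]) : set (cseq R p) :=
  [set f | T (f, fun n => z *: f n)].

Definition has_dim (R : realType) (p : nat) (V : set (cseq R p)) (k : nat)
    : Prop :=
  exists b : 'I_k -> cseq R p,
    (forall a : 'I_k -> R[i],
       (forall n, \sum_(j < k) a j *: b j n = 0) -> forall j, a j = 0) /\
    V = [set f | exists a : 'I_k -> R[i],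
                   forall n, f n = \sum_(j < k) a j *: b j n].

(* n_+(T) = dim ker (T^* - iI) and n_-(T) = dim ker (T^* + iI) *)
Definition deficiency_indices (R : realType) (p : nat)
    (T : set (cseq R p * cseq R p)) (nplus nminus : nat) : Prop :=
  has_dim (ker_shift (op_adjoint T) 'i%C) nplus /\
  has_dim (ker_shift (op_adjoint T) (- 'i%C)) nminus.

Definition nu (R : realType) (c x : R) : R :=
  c * x / Num.sqrt (1 + c ^+ 2 * x ^+ 2).

(* With j = n./2, the index n is 2j or 2j+1 according to its parity. The
   sequences d and beta are indexed from 1: their values at 0 are never used. *)
Definition diagXb (R : realType) (p : nat) (c : R) (d : nat -> R)
    (beta : nat -> 'M[R[i]]_p) (n : nat) : 'M[R[i]]_p :=
  let j := n./2 in
  if odd n then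
    - (nu c (d j.+1) ^+ 2 / d j.+1 ^+ 3)%:C%C
      *: (beta j.+1 + ((d j.+1)%:C%C)%:M)
  else 0.

Definition offdiagXb (R : realType) (p : nat) (c : R) (d : nat -> R)
    (n : nat) : 'M[R[i]]_p :=
  let j := n./2 in
  if odd n then
    ((nu c (d j.+1) / (d j.+1 `^ (3 / 2) * d j.+2 `^ (1 / 2)))%:C%C)%:M
  else ((nu c (d j.+1) / d j.+1 ^+ 2)%:C%C)%:M.

Definition jacobiXb (R : realType) (p : nat) (c : R) (d : nat -> R)
    (beta : nat -> 'M[R[i]]_p) : set (cseq R p * cseq R p) :=
  min_jacobi (diagXb c d beta) (offdiagXb p c d).

(* Main.v *)
Require Import Defs.
From mathcomp Require Import all_boot all_order all_algebra.
From mathcomp Require Import all_classical reals ereal topology normedtype.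
From mathcomp Require Import sequences exp.
From mathcomp Require Import complex.
From mathcomp Require Import ring lra.

(** The deficiency spaces of a block Jacobi operator consist of the
square-summable solutions of the three-term recurrence
  B_(n-1)^* f_(n-1) + A_n f_n + B_n f_(n+1) = z f_n,   z = i or z = -i.
The B_n being invertible, a solution is determined by f_0 in C^p, and f_0 is
arbitrary; so it is enough that every solution is square-summable
([deficiency_dim]). That the kernel of the adjoint is cut out by the recurrence
comes from Green's formula ([green]): tested on finitely supported sequences it
forces the recurrence, and conversely it gives <J g, f> = <g, z f> for a
square-summable solution f and every finitely supported g, an identity that
survives the closure because the l^2 pairing is continuous
([ker_shift_adjointP]).

To bound the solutions, put D_j = d_(j+1), q_j = sqrt (1 + c^2 D_j^2) and
  f_(2j) = sqrt D_j u_j,   f_(2j+1) = q_j sqrt D_j w_j.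
The square roots in the coefficients cancel and the recurrence turns into
  w_(j+1) = - w_j + (z D_(j+1) / c) u_(j+1),
  u_(j+1) = - u_j + c beta_(j+1) w_j + (c D_j + z q_j^2 D_j / c) w_j
([odd_part_rec], [even_part_rec]). Up to terms of size O(D_j), one step
multiplies |u_j| + |w_j| by at most 1 + c |beta_(j+1)|. Since the d_n are
summable, the O(D_j) terms only contribute a bounded factor ([growth_bound]), so
|u_j| + |w_j| is at most a constant times the product P_j of the
1 + c |beta_k| over k <= j. Hence |f_(2j)|^2 + |f_(2j+1)|^2 is at most a constant
times d_(j+1) P_j^2, the general term of the series assumed to converge
([solution_l2]). *)

Set Implicit Arguments.
Unset Strict Implicit.
Unset Printing Implicit Defensive.

Import Order.TTheory GRing.Theory Num.Theory.
Import numFieldNormedType.Exports.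

Local Open Scope classical_set_scope.
Local Open Scope ring_scope.
Local Open Scope sesquilinear_scope.

Import Normc.

Local Notation re := (@complex.Re _).
Local Notation im := (@complex.Im _).

(** * Complex numbers *)

Section ComplexNumbers.
Variable R : realType.
Implicit Types (x y z : R[i]) (t : R).

Lemma normc_ge0 z : 0 <= normc z.
Proof. by case: z => a b; rewrite /= sqrtr_ge0. Qed.

Lemma normc_sqr z : normc z ^+ 2 = re z ^+ 2 + im z ^+ 2.
Proof. by case: z => a b; rewrite /= sqr_sqrtr // addr_ge0 ?sqr_ge0. Qed.

Lemma normc_real t : 0 <= t -> normc t%:C%C = t.
Proof. by move=> t0; rewrite /= expr0n /= addr0 sqrtr_sqr ger0_norm. Qed.

Lemma normc_conj z : normc z^* = normc z.
Proof. by case: z => a b; rewrite /= sqrrN. Qed.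

Lemma Re_le_normc z : `|re z| <= normc z.
Proof.
by case: z => a b; rewrite /= -sqrtr_sqr ler_sqrt ?addr_ge0 ?sqr_ge0 // lerDl sqr_ge0.
Qed.

Lemma Im_le_normc z : `|im z| <= normc z.
Proof.
by case: z => a b; rewrite /= -sqrtr_sqr ler_sqrt ?addr_ge0 ?sqr_ge0 // lerDr sqr_ge0.
Qed.

Lemma young (a b t : R) : 0 < t -> a * b <= (t * a ^+ 2 + t^-1 * b ^+ 2) / 2.
Proof.
move=> t0; rewrite -subr_ge0.
have -> : (t * a ^+ 2 + t^-1 * b ^+ 2) / 2 - a * b = t^-1 * (t * a - b) ^+ 2 / 2.
  by field; rewrite gt_eqF.
by rewrite divr_ge0 // mulr_ge0 ?sqr_ge0 // invr_ge0 ltW.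
Qed.

Lemma normcD_sqr_le x y t : 0 < t ->
  normc (x + y) ^+ 2 <= (1 + t) * normc x ^+ 2 + (1 + t^-1) * normc y ^+ 2.
Proof.
move=> t0; rewrite !normc_sqr !raddfD /=.
by have := young (re x) (re y) t0; have := young (im x) (im y) t0; lra.
Qed.

(** Lets complex series inherit their convergence from the completeness of the
    reals, through their real and imaginary parts. *)
Lemma cvg_complex (a b : R^nat) (la lb : R) : a @ \oo --> la -> b @ \oo --> lb ->
  (fun n => (a n +i* b n)%C : R[i]^o) @ \oo --> ((la +i* lb)%C : R[i]^o).
Proof.
move=> /cvgrPdist_lt ha /cvgrPdist_lt hb; apply/cvgrPdist_lt => e e0.
have [re0 ee] : 0 < re e /\ e = (re e)%:C%C.
  by case: e e0 => x y; rewrite ltcE /= => /andP[/eqP -> ->].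
have re2 : 0 < re e / 2 by rewrite divr_gt0.
near=> n; rewrite ee normc_def ltcR.
have -> : (la +i* lb)%C - (a n +i* b n)%C = ((la - a n) +i* (lb - b n))%C :> R[i] by [].
rewrite /=.
have an : `|la - a n| < re e / 2 by near: n; exact: ha.
have bn : `|lb - b n| < re e / 2 by near: n; exact: hb.
rewrite -[ltRHS]gtr0_norm // -sqrtr_sqr ltr_sqrt ?exprn_gt0 //.
rewrite -(real_normK (num_real (la - a n))) -(real_normK (num_real (lb - b n))).
have := normr_ge0 (la - a n); have := normr_ge0 (lb - b n); nra.
Unshelve. all: by end_near. Qed.

End ComplexNumbers.

(** * Euclidean norm, operator norm and scalar product *)

Section Vectors.
Variables (R : realType) (p : nat).
Implicit Types (u v w : 'cV[R[i]]_p) (M : 'M[R[i]]_p).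

Lemma vnorm_ge0 u : 0 <= vnorm u.
Proof. exact: sqrtr_ge0. Qed.

Lemma vnorm_sqr u : vnorm u ^+ 2 = \sum_(k < p) normc (u k 0) ^+ 2.
Proof. by rewrite sqr_sqrtr // sumr_ge0 // => k _; rewrite sqr_ge0. Qed.

Lemma vnorm_eq0 u : vnorm u = 0 -> u = 0.
Proof.
move=> u0; have /eqP := vnorm_sqr u; rewrite u0 expr0n /= eq_sym psumr_eq0; last first.
  by move=> k _; rewrite sqr_ge0.
move=> /allP uk; apply/matrixP => k j; rewrite ord1 mxE.
by have := uk k (mem_index_enum k); rewrite /= sqrf_eq0 => /eqP/eq0_normc.
Qed.

Lemma vnorm0 : vnorm (0 : 'cV[R[i]]_p) = 0.
Proof.
by rewrite /vnorm big1 ?sqrtr0 // => k _; rewrite mxE normc0 expr0n.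
Qed.

Lemma vnormZ (z : R[i]) u : vnorm (z *: u) = normc z * vnorm u.
Proof.
rewrite /vnorm -[X in X * _]ger0_norm ?normc_ge0 // -sqrtr_sqr -sqrtrM ?sqr_ge0 //.
by congr Num.sqrt; rewrite mulr_sumr; apply: eq_bigr => k _; rewrite mxE normcM exprMn.
Qed.

Lemma vnormN u : vnorm (- u) = vnorm u.
Proof.
by rewrite /vnorm; congr Num.sqrt; apply: eq_bigr => k _; rewrite mxE normcN.
Qed.

(** A weighted substitute for the Cauchy-Schwarz inequality: it passes from
    coordinates to vectors by summation, and the weight is chosen afterwards. *)
Lemma vnormD_sqr_le u v (t : R) : 0 < t ->
  vnorm (u + v) ^+ 2 <= (1 + t) * vnorm u ^+ 2 + (1 + t^-1) * vnorm v ^+ 2.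
Proof.
move=> t0; rewrite !vnorm_sqr !mulr_sumr -big_split; apply: ler_sum => k _.
by rewrite mxE; exact: normcD_sqr_le.
Qed.

(** The weight t = |v| / |u| is optimal: it makes the right-hand side of
    [vnormD_sqr_le] the square of |u| + |v|. *)
Lemma vnormD u v : vnorm (u + v) <= vnorm u + vnorm v.
Proof.
have [u0|un0] := eqVneq (vnorm u) 0.
  by rewrite u0 (vnorm_eq0 u0) !add0r.
have [v0|vn0] := eqVneq (vnorm v) 0.
  by rewrite v0 (vnorm_eq0 v0) !addr0.
have u0 : 0 < vnorm u by rewrite lt_def un0 vnorm_ge0.
have v0 : 0 < vnorm v by rewrite lt_def vn0 vnorm_ge0.
rewrite -ler_sqr ?nnegrE ?addr_ge0 ?vnorm_ge0 //.
apply: le_trans (vnormD_sqr_le u v (divr_gt0 v0 u0)) _.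
by rewrite le_eqVlt; apply/orP; left; apply/eqP; field; rewrite un0 vn0.
Qed.

Lemma vnorm_sum (I : finType) (F : I -> 'cV[R[i]]_p) :
  vnorm (\sum_i F i) <= \sum_i vnorm (F i).
Proof.
elim/big_ind2: _ => [|x a y b xa yb|//]; first by rewrite vnorm0.
exact: le_trans (vnormD _ _) (lerD xa yb).
Qed.

Lemma normc_le_vnorm u k : normc (u k 0) <= vnorm u.
Proof.
rewrite -ler_sqr ?nnegrE ?vnorm_ge0 ?normc_ge0 // vnorm_sqr (bigD1 k) //= lerDl.
by rewrite sumr_ge0 // => j _; rewrite sqr_ge0.
Qed.

Lemma mulmx_sum_col M v : M *m v = \sum_k v k 0 *: col k M.
Proof.
apply/matrixP => i j; rewrite ord1 mxE summxE; apply: eq_bigr => k _.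
by rewrite !mxE mulrC.
Qed.

(** The operator norm is a supremum in the reals, hence meaningful only once the
    images of the unit ball are known to be bounded; the sum of the norms of the
    columns is a crude bound. *)
Lemma opnorm_has_sup M :
  has_sup [set vnorm (M *m v) | v in [set v : 'cV[R[i]]_p | vnorm v <= 1]].
Proof.
split.
  by exists (vnorm (M *m 0)), 0 => //=; rewrite vnorm0.
exists (\sum_k vnorm (col k M)) => _ [v /= v1 <-].
rewrite mulmx_sum_col; apply: le_trans (vnorm_sum _) _; apply: ler_sum => k _.
rewrite vnormZ ler_piMl ?vnorm_ge0 //.
exact: le_trans (normc_le_vnorm _ _) v1.
Qed.

Lemma opnorm_ge0 M : 0 <= opnorm M.
Proof.
apply: le_trans (vnorm_ge0 (M *m 0)) _.
apply: sup_upper_bound; first exact: opnorm_has_sup.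
by exists 0 => //=; rewrite vnorm0.
Qed.

Lemma vnorm_mulmx M v : vnorm (M *m v) <= opnorm M * vnorm v.
Proof.
have [v0|vn0] := eqVneq (vnorm v) 0.
  by rewrite (vnorm_eq0 v0) mulmx0 vnorm0 mulr0.
have v0 : 0 < vnorm v by rewrite lt_def vn0 vnorm_ge0.
rewrite -ler_pdivrMr // mulrC.
rewrite -[X in X * _](@normc_real R) ?invr_ge0 ?vnorm_ge0 // -vnormZ scalemxAr.
apply: sup_upper_bound; first exact: opnorm_has_sup.
eexists; last reflexivity.
by rewrite /= vnormZ normc_real ?invr_ge0 ?vnorm_ge0 // mulVf.
Qed.

Lemma vdotDl u v w : vdot (u + v) w = vdot u w + vdot v w.
Proof. by rewrite /vdot -big_split; apply: eq_bigr => k _; rewrite mxE mulrDl. Qed.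

Lemma vdotDr u v w : vdot u (v + w) = vdot u v + vdot u w.
Proof.
by rewrite /vdot -big_split; apply: eq_bigr => k _; rewrite mxE raddfD mulrDr.
Qed.

Lemma vdotBl u v w : vdot (u - v) w = vdot u w - vdot v w.
Proof. by rewrite /vdot -sumrB; apply: eq_bigr => k _; rewrite !mxE mulrBl. Qed.

Lemma vdot0l u : vdot 0 u = 0.
Proof. by rewrite /vdot big1 // => k _; rewrite mxE mul0r. Qed.

Lemma vdot0r u : vdot u 0 = 0.
Proof. by rewrite /vdot big1 // => k _; rewrite mxE rmorph0 mulr0. Qed.

Lemma vdot_mulmx M u v : vdot (M *m u) v = vdot u (M^t* *m v).
Proof.
rewrite /vdot.
under eq_bigr do rewrite mxE mulr_suml.
rewrite exchange_big /=; apply: eq_bigr => k _.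
rewrite mxE rmorph_sum mulr_sumr; apply: eq_bigr => j _.
by rewrite !mxE rmorphM /= conjCK mulrCA mulrA.
Qed.

Lemma adjmxK M : (M^t*)^t* = M.
Proof. by apply/matrixP => i j; rewrite !mxE conjCK. Qed.

Lemma vdot_adjmx M u v : vdot (M^t* *m u) v = vdot u (M *m v).
Proof. by rewrite vdot_mulmx adjmxK. Qed.

Lemma vdot_delta k u : vdot (delta_mx k 0) u = (u k 0)^*.
Proof.
rewrite /vdot (bigD1 k) //= mxE !eqxx mul1r big1 ?addr0 // => j jk.
by rewrite mxE (negbTE jk) mul0r.
Qed.

(** This is Cauchy-Schwarz in additive form: unlike the product of the norms,
    the right-hand side can be summed along sequences directly. *)
Lemma normc_vdot_le u v (t : R) : 0 < t ->
  normc (vdot u v) <= (t * vnorm u ^+ 2 + t^-1 * vnorm v ^+ 2) / 2.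
Proof.
move=> t0; rewrite !vnorm_sqr !mulr_sumr -big_split /= mulr_suml /vdot.
elim/big_ind2: _ => [|x a y b xa yb|k _]; first by rewrite normc0.
  exact: le_trans (le_normcD _ _) (lerD xa yb).
by rewrite normcM normc_conj; exact: young.
Qed.

End Vectors.

(** * Square-summable sequences *)

Section SquareSummable.
Variables (R : realType) (p : nat).
Implicit Types (f g h : cseq R p).

Lemma nonneg_series_cvg (a : R^nat) (C : R) : (forall n, 0 <= a n) ->
  (forall N, series a N <= C) -> cvgn (series a).
Proof.
move=> a0 aC; apply: nondecreasing_is_cvgn; first exact: nondecreasing_series.
by exists C => _ [N _ <-].
Qed.

Lemma l2_bounded f (C : R) :
  (forall N, \sum_(0 <= n < N) vnorm (f n) ^+ 2 <= C) -> l2 f.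
Proof. by apply: nonneg_series_cvg => n; rewrite sqr_ge0. Qed.

Lemma l2_series_le f N : l2 f -> series (fun n => vnorm (f n) ^+ 2) N <= l2norm f ^+ 2.
Proof.
move=> f2.
have nd : nondecreasing_seq (series (fun n => vnorm (f n) ^+ 2)).
  by apply: nondecreasing_series => n _ _; rewrite sqr_ge0.
have le N' := nondecreasing_cvgn_le nd f2 N'.
rewrite /l2norm sqr_sqrtr //.
by apply: le_trans (le 0%N); rewrite /series /= big_geq.
Qed.

Lemma l2Z (z : R[i]) f : l2 f -> l2 (fun n => z *: f n).
Proof.
move=> f2; apply: (@l2_bounded _ (normc z ^+ 2 * l2norm f ^+ 2)) => N.
under eq_bigr do rewrite vnormZ exprMn.
by rewrite -mulr_sumr ler_wpM2l ?sqr_ge0 //; exact: l2_series_le.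
Qed.

Lemma l2B f g : l2 f -> l2 g -> l2 (fun n => f n - g n).
Proof.
move=> f2 g2; apply: (@l2_bounded _ (2 * l2norm f ^+ 2 + 2 * l2norm g ^+ 2)) => N.
apply: le_trans
  (_ : \sum_(0 <= n < N) (2 * vnorm (f n) ^+ 2 + 2 * vnorm (g n) ^+ 2) <= _).
  apply: ler_sum => n _; have := vnormD_sqr_le (f n) (- g n) ltr01.
  by rewrite vnormN invr1.
by rewrite big_split -!mulr_sumr lerD // ler_wpM2l //; exact: l2_series_le.
Qed.

Lemma fin_supp_l2 f : fin_supp f -> l2 f.
Proof.
move=> [N fN]; apply/cvg_ex; exists (series (fun n => vnorm (f n) ^+ 2) N).
apply: (@cvg_near_cst _ _ _ _ _ _).
exists N => // n /= Nn.
rewrite /series /= (big_cat_nat _ Nn) //= -[RHS]addr0; congr (_ + _).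
by rewrite big_nat big1 // => k /andP[Nk _]; rewrite fN // vnorm0 expr0n.
Qed.

Lemma normc_series_vdot_le f g (t : R) N : 0 < t -> l2 f -> l2 g ->
  \sum_(0 <= n < N) normc (vdot (f n) (g n)) <=
  (t * l2norm f ^+ 2 + t^-1 * l2norm g ^+ 2) / 2.
Proof.
move=> t0 f2 g2; apply: le_trans (ler_sum _ (fun n _ => normc_vdot_le _ _ t0)) _.
rewrite -mulr_suml ler_wpM2r ?invr_ge0 // big_split -!mulr_sumr.
by rewrite lerD // ler_wpM2l ?invr_ge0 ?(ltW t0) //; exact: l2_series_le.
Qed.

(** [F] stands for the real part or the imaginary part. *)
Lemma dominated_series_cvg (F : R[i] -> R) f g :
  (forall z, `|F z| <= normc z) -> l2 f -> l2 g ->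
  cvgn (series (fun n => F (vdot (f n) (g n)))).
Proof.
move=> Fle f2 g2; apply: normed_cvg.
apply: (@nonneg_series_cvg _ ((1 * l2norm f ^+ 2 + 1^-1 * l2norm g ^+ 2) / 2))
  => [n|N] /=.
  exact: normr_ge0.
by apply: le_trans (normc_series_vdot_le N ltr01 f2 g2); exact: ler_sum.
Qed.

Lemma l2dot_is_cvg f g : l2 f -> l2 g ->
  cvgn (series (fun n => vdot (f n) (g n) : R[i]^o)).
Proof.
move=> f2 g2.
have cr := dominated_series_cvg (@Re_le_normc R) f2 g2.
have ci := dominated_series_cvg (@Im_le_normc R) f2 g2.
apply/cvg_ex; eexists.
suff -> : series (fun n => vdot (f n) (g n) : R[i]^o) =
    (fun N => (series (fun n => re (vdot (f n) (g n))) N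
               +i* series (fun n => im (vdot (f n) (g n))) N)%C : R[i]^o).
  exact: cvg_complex cr ci.
apply/funext => N; rewrite /series /=.
elim: N => [|N IH]; first by rewrite !big_geq.
by rewrite !big_nat_recr //= IH; case: (vdot (f N) (g N)).
Qed.

Lemma normc_lim_le (s : nat -> R[i]^o) (l : R[i]^o) (C : R) : s @ \oo --> l ->
  (forall N, normc (s N) <= C) -> normc l <= C.
Proof.
move=> /cvgrPdist_lt sl sC; apply/ler_addgt0Pr => e e0.
have e0' : 0 < (e%:C)%C :> R[i] by rewrite ltcR.
have [N _ /(_ N (leqnn N))] := sl _ e0'.
rewrite /= normc_def ltcR => sN.
rewrite -[l in normc l](subrK (s N)).
apply: le_trans (le_normcD _ _) _; rewrite addrC lerD //.
by move: sN; case: (l - s N) => a b /ltW.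
Qed.

Lemma normc_l2dot_le f g (t : R) : 0 < t -> l2 f -> l2 g ->
  normc (l2dot f g) <= (t * l2norm f ^+ 2 + t^-1 * l2norm g ^+ 2) / 2.
Proof.
move=> t0 f2 g2; apply: normc_lim_le (l2dot_is_cvg f2 g2) _ => N.
apply: le_trans (normc_series_vdot_le N t0 f2 g2).
rewrite /series /=.
elim/big_ind2: _ => [|x a y b xa yb|//]; first by rewrite normc0.
exact: le_trans (le_normcD _ _) (lerD xa yb).
Qed.

Lemma l2dotBl f f' g : l2 f -> l2 f' -> l2 g ->
  l2dot (fun n => f n - f' n) g = l2dot f g - l2dot f' g.
Proof.
move=> f2 f2' g2; rewrite /l2dot.
under [fun n => vdot _ _]funext do rewrite vdotBl.
by rewrite lim_seriesB //; exact: l2dot_is_cvg.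
Qed.

(** Meant for pairings in which one of the sequences is finitely supported. *)
Lemma l2dot_eventually f g N (z : R[i]) :
  (forall n, (N <= n)%N -> \sum_(0 <= k < n) vdot (f k) (g k) = z) -> l2dot f g = z.
Proof.
move=> H.
apply: (@lim_near_cst (R[i]^o) _ _ _ _ z); first exact: norm_hausdorff.
by exists N.
Qed.

Lemma l2dot_delta n k f :
  l2dot (fun m => if m == n then delta_mx k 0 else 0) f = (f n k 0)^*.
Proof.
apply: (@l2dot_eventually _ _ n.+1) => N nN.
rewrite (big_cat_nat _ nN) // big_nat_recr //= eqxx vdot_delta.
rewrite big_nat big1 ?add0r; last by move=> i /andP[_ /ltn_eqF ->]; rewrite vdot0l.
rewrite big_nat big1 ?addr0 // => i /andP[/gtn_eqF -> _]; exact: vdot0l.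
Qed.

End SquareSummable.

(** * Deficiency spaces of a block Jacobi operator *)

Lemma sumB_recr (V : zmodType) (F G : nat -> V) N :
  \sum_(0 <= n < N.+1) F n - \sum_(0 <= n < N.+1) G n =
  \sum_(0 <= n < N) F n - \sum_(0 <= n < N) G n + (F N - G N).
Proof. by rewrite !big_nat_recr //= opprD addrACA. Qed.

Section JacobiOperator.
Variables (R : realType) (p : nat) (A B : nat -> 'M[R[i]]_p).
Implicit Types (f g h : cseq R p).
Hypothesis A_selfadjoint : forall n, (A n)^t* = A n.

(** Green's formula. Each matrix moves to the other side of the scalar product as
    its adjoint, so the sum telescopes and only the Wronskian at [N] is left. *)
Lemma green f g N :
  \sum_(0 <= n < N.+1) vdot (jacobi_map A B f n) (g n)
  - \sum_(0 <= n < N.+1) vdot (f n) (jacobi_map A B g n) =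
  vdot (B N *m f N.+1) (g N) - vdot (f N) (B N *m g N.+1).
Proof.
have vdotA n : vdot (A n *m f n) (g n) = vdot (f n) (A n *m g n).
  by rewrite vdot_mulmx A_selfadjoint.
elim: N => [|N IH].
  rewrite !big_nat1 /jacobi_map !vdotDl !vdotDr vdot0l vdot0r vdotA; ring.
rewrite sumB_recr IH /=.
rewrite !vdotDl !vdotDr vdotA vdot_adjmx -vdot_mulmx; ring.
Qed.

Lemma fin_supp_jacobi f : fin_supp f -> fin_supp (jacobi_map A B f).
Proof.
move=> [N fN]; exists N.+1 => -[//|n] nN.
have Nn : (N <= n)%N by [].
by rewrite /jacobi_map !fN ?mulmx0 ?addr0 // !leqW.
Qed.

Lemma l2dot_jacobi f g : fin_supp f ->
  l2dot (jacobi_map A B f) g = l2dot f (jacobi_map A B g).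
Proof.
move=> [N fN].
have stable n : (N.+1 <= n)%N -> \sum_(0 <= k < n) vdot (f k) (jacobi_map A B g k) =
    \sum_(0 <= k < N.+1) vdot (f k) (jacobi_map A B g k).
  move=> Nn; rewrite (big_cat_nat _ Nn) //= -[RHS]addr0; congr (_ + _).
  by rewrite big_nat big1 // => k /andP[/ltnW Nk _]; rewrite fN // vdot0l.
rewrite [RHS](l2dot_eventually stable).
apply: (@l2dot_eventually _ _ _ _ N.+1) => -[//|n] Nn.
rewrite -(stable _ Nn); apply/eqP; rewrite -subr_eq0 green.
by rewrite !fN ?mulmx0 ?vdot0l ?subr0 // leqW.
Qed.

Lemma l2norm_subrr f : l2norm (fun n => f n - f n) = 0.
Proof.
rewrite /l2norm.
under [fun n => vnorm _ ^+ 2]funext do rewrite subrr vnorm0 expr0n.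
have -> : series (fun=> (0 : R)) = fun=> 0.
  by apply/funext => N; rewrite /series /= big1.
by rewrite lim_cst // sqrtr0.
Qed.

Lemma pre_jacobi_sub_min : pre_jacobi A B `<=` min_jacobi A B.
Proof.
move=> [f h] [/= fs ->].
have f2 := fin_supp_l2 fs; have Jf2 := fin_supp_l2 (fin_supp_jacobi fs).
split=> //= e e0; exists (f, jacobi_map A B f) => //=.
by rewrite !l2norm_subrr.
Qed.

(** Continuity of the pairing in its first argument, from [normc_l2dot_le] with
    weight 1 / e. *)
Lemma l2dot_close (f f' g : cseq R p) (e : R) : 0 < e -> l2 f -> l2 f' -> l2 g ->
  l2norm (fun n => f n - f' n) < e ->
  normc (l2dot f g - l2dot f' g) <= e * ((1 + l2norm g ^+ 2) / 2).
Proof.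
move=> e0 f2 f'2 g2 ffe; rewrite -l2dotBl //.
have ei0 : 0 < e^-1 by rewrite invr_gt0.
apply: le_trans (normc_l2dot_le ei0 (l2B f2 f'2) g2) _.
rewrite invrK mulrA ler_wpM2r ?invr_ge0 // mulrDr mulr1 lerD2r.
rewrite mulrC ler_pdivrMr // -expr2 ler_sqr ?nnegrE ?(ltW ffe) ?(ltW e0) //.
exact: sqrtr_ge0.
Qed.

(** Testing against the unit vector supported at [n] gives the [n]-th equation of
    the recurrence. Conversely, symmetry on finitely supported sequences extends
    to the closure by approximating both components of a pair of the graph. *)
Lemma ker_shift_adjointP (z : R[i]) f :
  ker_shift (op_adjoint (min_jacobi A B)) z f <->
  l2 f /\ jacobi_map A B f = (fun n => z *: f n).
Proof.
split=> [[/= f2 zf2 adj]|[f2 Jf]].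
  split=> //; apply/funext => n; apply/matrixP => k j; rewrite ord1.
  pose g : cseq R p := fun m => if m == n then delta_mx k 0 else 0.
  have gs : fin_supp g by exists n.+1 => m nm; rewrite /g gtn_eqF.
  have gT : min_jacobi A B (g, jacobi_map A B g) by exact: pre_jacobi_sub_min.
  have := adj _ gT.
  rewrite /= (l2dot_jacobi _ gs) !l2dot_delta => /(congr1 Num.conj).
  by rewrite !conjCK.
have zf2 := @l2Z _ _ z _ f2.
split=> //= -[g k] [/= g2 k2 approx].
apply/eqP; rewrite -subr_eq0; apply/eqP/eq0_normc/le_anti.
rewrite normc_ge0 andbT.
(* [C] collects the constants of the two uses of [l2dot_close] below. *)
set C := (1 + l2norm f ^+ 2) / 2 + (1 + l2norm (fun n => z *: f n) ^+ 2) / 2.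
have C0 : 0 < C by rewrite addr_gt0 ?divr_gt0 ?ltr_wpDr ?sqr_ge0.
apply/ler_addgt0Pr => e e0; rewrite add0r.
have eC0 : 0 < e / C by rewrite divr_gt0.
have [[g' k'] [/= gs ->] [/= g'2 Jg'2 gg' kk']] := approx _ eC0.
have := l2dot_jacobi f gs; rewrite Jf => sym.
have -> : l2dot k f - l2dot g (fun n => z *: f n) =
    (l2dot k f - l2dot (jacobi_map A B g') f) +
    - (l2dot g (fun n => z *: f n) - l2dot g' (fun n => z *: f n)).
  by rewrite sym; ring.
apply: le_trans (le_normcD _ _) _; rewrite normcN.
have close_k := l2dot_close eC0 k2 Jg'2 f2 kk'.
have close_g := l2dot_close eC0 g2 g'2 zf2 gg'.
apply: le_trans (lerD close_k close_g) _.
by rewrite -mulrDr -/C divfK // gt_eqF.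
Qed.

Hypothesis B_unit : forall n, B n \in unitmx.
Variable z : R[i].

(** The recurrence has order two, so consecutive values are built together: the
    pair at [n] holds the matrices sending f_0 to f_n and to f_(n+1). *)
Fixpoint transfer_pair n : 'M[R[i]]_p * 'M[R[i]]_p :=
  if n is m.+1 then
    let XY := transfer_pair m in
    (XY.2, invmx (B m.+1) *m (z *: XY.2 - A m.+1 *m XY.2 - (B m)^t* *m XY.1))
  else (1%:M, invmx (B 0%N) *m (z%:M - A 0%N)).

Definition transfer n := (transfer_pair n).1.

Lemma transfer_solution v :
  jacobi_map A B (fun n => transfer n *m v) = (fun n => z *: (transfer n *m v)).
Proof.
apply/funext => -[|n]; rewrite /jacobi_map /transfer /=.
  by rewrite add0r !mul1mx -!mulmxA mulKVmx // mulmxBl mul_scalar_mx addrC subrK.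
rewrite -!mulmxA mulKVmx // !mulmxBl -scalemxAl -!mulmxA.
move: ((B n)^t* *m _) (A n.+1 *m _) (z *: _) => a b e.
by rewrite [LHS]addrC -[e - b - a]addrA -opprD [b + a]addrC subrK.
Qed.

Lemma solution_transfer f n :
  jacobi_map A B f = (fun n => z *: f n) -> f n = transfer n *m f 0%N.
Proof.
move=> Jf.
have step m : f m.+1 = invmx (B m) *m
    (z *: f m - A m *m f m - (if m is l.+1 then (B l)^t* *m f l else 0)).
  have := congr1 (@^~ m) Jf; rewrite /jacobi_map => <-.
  rewrite [X in invmx _ *m X](_ : _ = B m *m f m.+1) ?mulKmx //.
  move: (if _ is _.+1 then _ else _) (A m *m _) => a b.
  by rewrite -[LHS]addrA -opprD [b + a]addrC [LHS]addrC addKr.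
suff [] : f n = (transfer_pair n).1 *m f 0%N /\
    f n.+1 = (transfer_pair n).2 *m f 0%N by [].
elim: n => [|n [IH1 IH2]] /=.
  by rewrite mul1mx step subr0 -mulmxA mulmxBl mul_scalar_mx.
split=> //.
by rewrite step IH1 IH2 -!mulmxA !mulmxBl -scalemxAl -!mulmxA.
Qed.

Lemma mulmx_col_sum (M : 'M[R[i]]_p) (a : 'I_p -> R[i]) :
  M *m (\col_j a j) = \sum_j a j *: col j M.
Proof. by rewrite mulmx_sum_col; apply: eq_bigr => j _; rewrite mxE. Qed.

(** The columns of the transfer matrices are solutions with the canonical basis
    as initial values: they are independent already at index 0, and span since a
    solution is determined by its initial value. *)
Lemma deficiency_dim :
  (forall f, jacobi_map A B f = (fun n => z *: f n) -> l2 f) ->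
  has_dim (ker_shift (op_adjoint (min_jacobi A B)) z) p.
Proof.
move=> all_l2; exists (fun j n => col j (transfer n)); split.
  move=> a /(_ 0%N); rewrite -mulmx_col_sum mul1mx => a0 j.
  by have := congr1 (fun u : 'cV_p => u j 0) a0; rewrite !mxE.
apply/seteqP; split=> [f /ker_shift_adjointP[_ Jf]|f [a fa]] /=.
  exists (fun j => f 0%N j 0) => n.
  rewrite -mulmx_col_sum {1}(solution_transfer n Jf); congr (_ *m _).
  by apply/matrixP => i j; rewrite ord1 mxE.
have Jf : jacobi_map A B f = (fun n => z *: f n).
  have -> : f = (fun n => transfer n *m (\col_j a j)).
    by apply/funext => n; rewrite mulmx_col_sum fa.
  exact: transfer_solution.
by apply/ker_shift_adjointP; split=> //; exact: all_l2.
Qed.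

End JacobiOperator.

(** * Growth of solutions of a perturbed recurrence *)

(** The perturbations of size K D are absorbed with 1 + x <= exp x. Each D_j
    enters the bounds of both W_j and U_(j+1), whence the two terms in the
    exponent. *)
Lemma growth_bound (R : realType) (U W b D : nat -> R) (K : R) : 0 <= K ->
  (forall j, 0 <= U j) -> (forall j, 0 <= W j) ->
  (forall j, 0 <= b j) -> (forall j, 0 <= D j) ->
  (forall j, W j.+1 <= W j + K * D j.+1 * U j.+1) ->
  (forall j, U j.+1 <= U j + (b j + K * D j) * W j) ->
  forall j, U j + W j <=
    (U 0%N + W 0%N) * (\prod_(0 <= i < j) (1 + b i))
    * expR (K * \sum_(0 <= i < j) (D i + D i.+1)).
Proof.
move=> K0 U0 W0 b0 D0 Wrec Urec; elim=> [|j IH].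
  by rewrite !big_geq // mulr0 expR0 !mulr1.
have KD n : 0 <= K * D n by rewrite mulr_ge0.
have step : U j.+1 + W j.+1 <=
    (U j + W j) * (1 + b j) * (expR (K * D j) * expR (K * D j.+1)).
  have h1 : U j.+1 + W j.+1 <= (1 + K * D j.+1) * (U j.+1 + W j).
    have := Wrec j; have := mulr_ge0 (KD j.+1) (W0 j); lra.
  have h2 : U j.+1 + W j <= (1 + K * D j) * ((1 + b j) * (U j + W j)).
    have := Urec j; have := mulr_ge0 (KD j) (U0 j); have := mulr_ge0 (b0 j) (U0 j).
    have := mulr_ge0 (KD j) (mulr_ge0 (b0 j) (U0 j)).
    have := mulr_ge0 (KD j) (mulr_ge0 (b0 j) (W0 j)); lra.
  apply: le_trans h1 _; rewrite mulrA mulrC.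
  apply: ler_pM; rewrite ?expR_ge1Dx ?addr_ge0 //.
  apply: le_trans h2 _; rewrite mulrC [(1 + b j) * _]mulrC.
  by apply: ler_pM; rewrite ?expR_ge1Dx ?addr_ge0 ?mulr_ge0 ?addr_ge0.
apply: le_trans step _.
rewrite !big_nat_recr //= ![K * (_ + _)]mulrDr !expRD.
set E := expR (K * _) in IH *; set e := expR _ * expR _.
have -> : (U 0%N + W 0%N) * (\prod_(0 <= i < j) (1 + b i) * (1 + b j)) * (E * e) =
   ((U 0%N + W 0%N) * \prod_(0 <= i < j) (1 + b i) * E) * (1 + b j) * e by ring.
by rewrite !ler_wpM2r ?mulr_ge0 ?expR_ge0 ?addr_ge0.
Qed.

(** * The rescaled recurrence *)

Lemma double_cases (P : nat -> Prop) :
  (forall j, P j.*2) -> (forall j, P j.*2.+1) -> forall n, P n.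
Proof.
move=> Pe Po n; rewrite -(odd_double_half n); case: (odd n); [exact: Po|exact: Pe].
Qed.

Lemma sum_double (V : nmodType) (F : nat -> V) N :
  \sum_(0 <= n < N.*2) F n = \sum_(0 <= j < N) (F j.*2 + F j.*2.+1).
Proof.
elim: N => [|N IH]; first by rewrite !big_geq.
by rewrite doubleS !big_nat_recr //= IH addrA.
Qed.

Lemma real_complexM (R : rcfType) (x y : R) : x%:C%C * y%:C%C = (x * y)%:C%C :> R[i].
Proof. by rewrite rmorphM. Qed.

Lemma real_complexN (R : rcfType) (x : R) : - x%:C%C = (- x)%:C%C :> R[i].
Proof. by rewrite rmorphN. Qed.

Lemma sum_sqr_le (R : realDomainType) (r t x y : R) : 0 <= x -> 0 <= y ->
  1 <= t -> r <= t -> x ^+ 2 + r * y ^+ 2 <= t * (x + y) ^+ 2.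
Proof.
move=> x0 y0 t1 rt; have := ler_wpM2r (sqr_ge0 x) t1.
have := ler_wpM2r (sqr_ge0 y) rt.
have := mulr_ge0 (le_trans ler01 t1) (mulr_ge0 x0 y0).
by rewrite sqrrD; lra.
Qed.

Lemma adjmx_real_scalar (R : realType) (p : nat) (x : R) :
  ((x%:C%C)%:M : 'M[R[i]]_p)^t* = (x%:C%C)%:M.
Proof.
apply/matrixP => i k; rewrite !mxE rmorphMn eq_sym; congr (_ *+ _).
exact: conjc_real.
Qed.

Section PointInteractions.
Variables (R : realType) (p : nat) (c : R) (d : nat -> R) (beta : nat -> 'M[R[i]]_p).
Hypothesis c_gt0 : 0 < c.
Hypothesis d_gt0 : forall n, (1 <= n)%N -> 0 < d n.

(* Every matrix entry is rational in c, d, beta and these two square roots. *)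
Let D j := d j.+1.
Let s j := Num.sqrt (D j).
Let q j := Num.sqrt (1 + c ^+ 2 * D j ^+ 2).

Let D_gt0 j : 0 < D j. Proof. exact: d_gt0. Qed.
Let s_gt0 j : 0 < s j. Proof. by rewrite sqrtr_gt0. Qed.
Let s_neq0 j : s j != 0. Proof. by rewrite gt_eqF. Qed.
Let c_neq0 : c != 0. Proof. by rewrite gt_eqF. Qed.
Let s_sqr j : s j ^+ 2 = D j. Proof. by rewrite sqr_sqrtr // ltW. Qed.

Let q_sqr j : q j ^+ 2 = 1 + c ^+ 2 * D j ^+ 2.
Proof. by rewrite sqr_sqrtr // addr_ge0 // mulr_ge0 ?sqr_ge0. Qed.

Let q_gt0 j : 0 < q j.
Proof. by rewrite sqrtr_gt0 ltr_wpDr // mulr_ge0 ?sqr_ge0. Qed.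

Let q_neq0 j : q j != 0. Proof. by rewrite gt_eqF. Qed.

Lemma nu_eq j : nu c (D j) = c * s j ^+ 2 / q j.
Proof. by rewrite /nu s_sqr. Qed.

Lemma offdiag_even j : offdiagXb p c d j.*2 = ((c / (q j * s j ^+ 2))%:C%C)%:M.
Proof.
rewrite /offdiagXb odd_double doubleK -/(D j) nu_eq -s_sqr; congr (_%:C%C)%:M.
by field; rewrite q_neq0 s_neq0.
Qed.

Lemma offdiag_odd j : offdiagXb p c d j.*2.+1 = ((c / (q j * s j * s j.+1))%:C%C)%:M.
Proof.
rewrite /offdiagXb /= odd_double /= uphalf_double -/(D j) -/(D j.+1) nu_eq.
rewrite div1r powR12_sqrt ?ltW // -/(s j.+1).
rewrite [3 / 2]mulrC powRrM powR12_sqrt ?ltW // -/(s j) powR_mulrn ?ltW //.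
by congr (_%:C%C)%:M; field; rewrite q_neq0 !s_neq0.
Qed.

Lemma diag_even j : diagXb c d beta j.*2 = 0.
Proof. by rewrite /diagXb odd_double. Qed.

Lemma diag_odd j : diagXb c d beta j.*2.+1 =
  - (c ^+ 2 / (q j ^+ 2 * s j ^+ 2))%:C%C *: (beta j.+1 + ((D j)%:C%C)%:M).
Proof.
rewrite /diagXb /= odd_double /= uphalf_double -/(D j) nu_eq.
congr (- _%:C%C *: _); rewrite -s_sqr.
by field; rewrite q_neq0 s_neq0.
Qed.

Lemma offdiag_unit n : offdiagXb p c d n \in unitmx.
Proof.
have cne0 (x : R) : x != 0 -> ((x%:C%C)%:M : 'M[R[i]]_p) \in unitmx.
  move=> x0; rewrite unitmxE det_scalar unitrX // unitfE.
  by apply: contra x0 => /eqP/complexI ->.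
elim/double_cases: n => j; rewrite (offdiag_even, offdiag_odd) cne0 //;
  by rewrite mulf_neq0 // invr_neq0 // !mulf_neq0 // expf_neq0.
Qed.

Lemma diag_selfadjoint n : (forall k, (1 <= k)%N -> (beta k)^t* = beta k) ->
  (diagXb c d beta n)^t* = diagXb c d beta n.
Proof.
move=> beta_sa; elim/double_cases: n => j; rewrite (diag_even, diag_odd).
  by apply/matrixP => i k; rewrite !mxE rmorph0.
apply/matrixP => i k; rewrite -[in RHS](beta_sa j.+1) // !mxE.
rewrite rmorphM rmorphN rmorphD rmorphMn /= eq_sym.
have conj_real (x : R) : (x%:C%C : R[i])^* = (x%:C)%C by exact: conjc_real.
by rewrite !conj_real.
Qed.

Section Solution.
Variables (z : R[i]) (f : cseq R p).
Hypothesis f_sol :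
  jacobi_map (diagXb c d beta) (offdiagXb p c d) f = (fun n => z *: f n).

Definition even_part j := ((s j)^-1%:C)%C *: f j.*2.
Definition odd_part j := ((q j * s j)^-1%:C)%C *: f j.*2.+1.
Local Notation u := even_part.
Local Notation w := odd_part.

Let f_even j : f j.*2 = ((s j)%:C)%C *: u j.
Proof. by rewrite scalerA real_complexM mulfV // scale1r. Qed.

Let f_odd j : f j.*2.+1 = ((q j * s j)%:C)%C *: w j.
Proof. by rewrite scalerA real_complexM mulfV ?scale1r // mulf_neq0. Qed.

Let vnorm_even j : vnorm (f j.*2) = s j * vnorm (u j).
Proof. by rewrite (f_even j) vnormZ (normc_real (ltW (s_gt0 j))). Qed.

Let vnorm_odd j : vnorm (f j.*2.+1) = q j * s j * vnorm (w j).
Proof.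
by rewrite (f_odd j) vnormZ (normc_real (mulr_ge0 (ltW (q_gt0 j)) (ltW (s_gt0 j)))).
Qed.

(** The equation of even index, times sqrt D_(j+1) / c. *)
Lemma odd_part_rec j : w j.+1 = - w j + (z * (D j.+1 / c)%:C%C) *: u j.+1.
Proof.
have := congr1 (fun h => (s j.+1 / c)%:C%C *: h j.+1.*2) f_sol.
rewrite /jacobi_map doubleS -doubleS diag_even mul0mx addr0.
rewrite doubleS /= -doubleS offdiag_odd offdiag_even adjmx_real_scalar !mul_scalar_mx.
rewrite (f_even j.+1) (f_odd j) (f_odd j.+1).
move: (w j) (w j.+1) (u j.+1) => a a' b.
rewrite !scalerDr !scalerA [_ * z]mulrC -[z * _ * _]mulrA !real_complexM.
have -> : s j.+1 / c * (c / (q j * s j * s j.+1)) * (q j * s j) = 1.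
  by field; rewrite c_neq0 q_neq0 !s_neq0.
have -> : s j.+1 / c * (c / (q j.+1 * s j.+1 ^+ 2)) * (q j.+1 * s j.+1) = 1.
  by field; rewrite c_neq0 q_neq0 !s_neq0.
have -> : s j.+1 / c * s j.+1 = D j.+1 / c by rewrite -s_sqr; field.
by rewrite !scale1r => <-; rewrite addKr.
Qed.

(** The equation of odd index, times q_j sqrt D_j / c. *)
Lemma even_part_rec j :
  u j.+1 = - u j + c%:C%C *: (beta j.+1 *m w j)
           + ((c * D j)%:C%C + z * (q j ^+ 2 * D j / c)%:C%C) *: w j.
Proof.
have := congr1 (fun h => (q j * s j / c)%:C%C *: h j.*2.+1) f_sol.
rewrite /jacobi_map offdiag_odd offdiag_even adjmx_real_scalar diag_odd.
rewrite -doubleS -scalemxAl mulmxDl !mul_scalar_mx.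
rewrite (f_even j) (f_even j.+1) (f_odd j).
move: (w j) (u j) (u j.+1) => a b b'.
rewrite -scalemxAr !scalerDr !scalerA !real_complexN
  [_ * z]mulrC -[z * _ * _]mulrA !real_complexM.
have -> : q j * s j / c * (c / (q j * s j ^+ 2)) * s j = 1.
  by field; rewrite c_neq0 q_neq0 !s_neq0.
have -> : q j * s j / c * (c / (q j * s j * s j.+1)) * s j.+1 = 1.
  by field; rewrite c_neq0 q_neq0 !s_neq0.
have -> : q j * s j / c * - (c ^+ 2 / (q j ^+ 2 * s j ^+ 2)) * (q j * s j) = - c.
  by field; rewrite c_neq0 q_neq0 !s_neq0.
have -> : q j * s j / c * (- (c ^+ 2 / (q j ^+ 2 * s j ^+ 2)) * D j) * (q j * s j)
    = - (c * D j).
  by rewrite -s_sqr; field; rewrite c_neq0 q_neq0 !s_neq0.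
have -> : q j * s j / c * (q j * s j) = q j ^+ 2 * D j / c by rewrite -s_sqr; field.
rewrite !scale1r -!real_complexN !scaleNr scalerDl -opprD => <-.
set x := _ *: (_ *m _); set y := _ *: a.
rewrite addrA -[- b + x + y]addrA.
have -> : b - (x + y) = - (- b + (x + y)) by rewrite [RHS]opprD opprK.
by rewrite addNKr.
Qed.

(** * Square-summability of the solutions *)

Variable S : R.
Let b j := c * opnorm (beta j.+1).
Let P j := \prod_(0 <= i < j) (1 + b i).
Hypothesis weighted_le : forall N, \sum_(0 <= j < N) D j * P j ^+ 2 <= S.

Let b_ge0 j : 0 <= b j. Proof. by rewrite mulr_ge0 ?opnorm_ge0 ?ltW. Qed.

Let P_ge1 j : 1 <= P j.
Proof.
rewrite /P; elim/big_ind: _ => [//|x y x1 y1|i _]; last by rewrite lerDl.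
by rewrite -[leLHS]mulr1 ler_pM.
Qed.

(* The weights being at least 1, the hypothesis also makes d summable. *)
Let sum_D_le N : \sum_(0 <= j < N) D j <= S.
Proof.
apply: le_trans (weighted_le N); apply: ler_sum => j _.
by rewrite ler_peMr ?(ltW (D_gt0 j)) // exprn_ege1.
Qed.

Let D_le j : D j <= S.
Proof.
apply: le_trans (sum_D_le j.+1); rewrite big_nat_recr //= lerDr.
by apply: sumr_ge0 => i _; rewrite ltW.
Qed.

(* [Q] bounds all q_j^2; as Q >= 1, the constant [K] serves both recurrences. *)
Let Q := 1 + c ^+ 2 * S ^+ 2.
Let K := c + normc z * Q / c.

Let q_sqr_le j : q j ^+ 2 <= Q.
Proof.
rewrite q_sqr lerD2l ler_wpM2l ?sqr_ge0 // ler_sqr ?nnegrE ?(ltW (D_gt0 j)) //.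
exact: le_trans (ltW (D_gt0 j)) (D_le j).
Qed.

Let Q_ge1 : 1 <= Q. Proof. by rewrite lerDl mulr_ge0 ?sqr_ge0. Qed.

Lemma odd_part_le j :
  vnorm (w j.+1) <= vnorm (w j) + K * D j.+1 * vnorm (u j.+1).
Proof.
rewrite odd_part_rec; apply: le_trans (vnormD _ _) _.
rewrite vnormN lerD2l vnormZ ler_wpM2r ?vnorm_ge0 // normcM.
rewrite normc_real ?divr_ge0 ?(ltW (D_gt0 _)) ?(ltW c_gt0) //.
rewrite mulrCA [leLHS]mulrC ler_wpM2r ?(ltW (D_gt0 _)) //.
have zc : 0 <= normc z / c by rewrite divr_ge0 ?normc_ge0 ?(ltW c_gt0).
have -> : K = c + normc z / c * Q by rewrite /K; ring.
by apply: le_trans (_ : normc z / c * Q <= _); rewrite ?ler_peMr // lerDr (ltW c_gt0).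
Qed.

Lemma even_part_le j :
  vnorm (u j.+1) <= vnorm (u j) + (b j + K * D j) * vnorm (w j).
Proof.
rewrite even_part_rec -addrA; apply: le_trans (vnormD _ _) _.
rewrite vnormN lerD2l; apply: le_trans (vnormD _ _) _.
rewrite mulrDl; apply: lerD; rewrite vnormZ.
  by rewrite normc_real ?(ltW c_gt0) // /b -mulrA ler_wpM2l ?(ltW c_gt0) // vnorm_mulmx.
rewrite ler_wpM2r ?vnorm_ge0 //; apply: le_trans (le_normcD _ _) _.
have Dj0 := ltW (D_gt0 j); have c0 := ltW c_gt0.
rewrite normcM !normc_real ?divr_ge0 ?mulr_ge0 ?(ltW (q_gt0 j)) //.
rewrite /K mulrDl lerD2l.
have -> : normc z * (q j ^+ 2 * D j / c) = normc z / c * D j * q j ^+ 2 by ring.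
have -> : normc z * Q / c * D j = normc z / c * D j * Q by ring.
by rewrite ler_wpM2l // mulr_ge0 ?divr_ge0 ?normc_ge0.
Qed.

(** Entries are grouped in pairs (2j, 2j+1), whose squared norms are at most
    Q D_j (|u_j| + |w_j|)^2. *)
Lemma solution_l2 : l2 f.
Proof.
have K0 : 0 <= K.
  by rewrite addr_ge0 ?divr_ge0 ?mulr_ge0 ?normc_ge0 ?(le_trans ler01 Q_ge1) ?ltW.
set M := (vnorm (u 0%N) + vnorm (w 0%N)) * expR (K * (S + S)).
have M0 : 0 <= M by rewrite mulr_ge0 ?addr_ge0 ?vnorm_ge0 ?expR_ge0.
(* [S] bounds each of the two sums in the exponent of [growth_bound]. *)
have growth j : vnorm (u j) + vnorm (w j) <= M * P j.
  apply: le_trans (growth_bound K0 _ _ b_ge0 _ odd_part_le even_part_le j) _;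
    try by move=> i; rewrite ?vnorm_ge0 ?ltW.
  rewrite mulrAC ler_wpM2r ?(le_trans ler01 (P_ge1 j)) //.
  rewrite ler_wpM2l ?addr_ge0 ?vnorm_ge0 // ler_expR ler_wpM2l // big_split.
  apply: lerD; first exact: sum_D_le.
  apply: le_trans (sum_D_le j.+1).
  by rewrite big_nat_recl // lerDr (ltW (D_gt0 _)).
apply: (@l2_bounded _ _ _ (Q * M ^+ 2 * S)) => N.
apply: le_trans (_ : \sum_(0 <= n < N.*2) vnorm (f n) ^+ 2 <= _).
  rewrite [leRHS](@big_cat_nat _ _ _ N) //=; last by rewrite -addnn leq_addr.
  by rewrite lerDl sumr_ge0 // => n _; rewrite sqr_ge0.
rewrite sum_double.
apply: le_trans (_ : \sum_(0 <= j < N) Q * M ^+ 2 * (D j * P j ^+ 2) <= _); last first.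
  by rewrite -mulr_sumr ler_wpM2l // mulr_ge0 ?sqr_ge0 ?(le_trans ler01 Q_ge1).
apply: ler_sum => j _.
rewrite vnorm_even vnorm_odd; move: (growth j) (vnorm_ge0 (u j)) (vnorm_ge0 (w j)).
move: (vnorm (u j)) (vnorm (w j)) => U W UW U0 W0.
have -> : (s j * U) ^+ 2 + (q j * s j * W) ^+ 2 = D j * (U ^+ 2 + q j ^+ 2 * W ^+ 2).
  by rewrite -s_sqr; ring.
have -> : Q * M ^+ 2 * (D j * P j ^+ 2) = D j * (Q * (M * P j) ^+ 2) by ring.
rewrite ler_wpM2l ?(ltW (D_gt0 j)) //.
apply: le_trans (sum_sqr_le U0 W0 Q_ge1 (q_sqr_le j)) _.
rewrite ler_wpM2l ?(le_trans ler01 Q_ge1) // ler_sqr // nnegrE ?addr_ge0 //.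
exact: le_trans (addr_ge0 U0 W0) UW.
Qed.

End Solution.
End PointInteractions.

(** The series starts at n = 2 while the pairs start at j = 0, that is at n = 1:
    the term d_1, with empty product, is added separately. *)
Lemma weighted_sums_bounded (R : realType) (a : nat -> R) (d : nat -> R) :
  (forall n, (1 <= n)%N -> 0 < d n) ->
  (\sum_(2 <= n <oo) (d n * \prod_(1 <= k < n) a k ^+ 2)%:E < +oo)%E ->
  exists S : R, forall N,
    \sum_(0 <= j < N) d j.+1 * (\prod_(0 <= i < j) a i.+1) ^+ 2 <= S.
Proof.
move=> d_gt0 fin.
set T := fun n => d n * \prod_(1 <= k < n) a k ^+ 2.
have T0 n : (2 <= n)%N -> true -> (0%:E <= (T n)%:E)%E.
  move=> n2 _; rewrite lee_fin mulr_ge0 ?(ltW (d_gt0 _ _)) ?(ltnW n2) //.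
  by apply: prodr_ge0 => k _; rewrite sqr_ge0.
have sum_fin : (\sum_(2 <= n <oo) (T n)%:E)%E \is a fin_num.
  by rewrite ge0_fin_numE //; apply: nneseries_ge0.
exists (T 1%N + fine (\sum_(2 <= n <oo) (T n)%:E)%E) => N.
have TE j : d j.+1 * (\prod_(0 <= i < j) a i.+1) ^+ 2 = T j.+1.
  by rewrite /T big_add1 /= prodrXl.
under eq_bigr do rewrite TE.
case: N => [|N].
  rewrite big_geq // addr_ge0 //; last first.
    by rewrite fine_ge0 //; apply: nneseries_ge0.
  by rewrite /T big_geq // mulr1 ltW // d_gt0.
rewrite big_nat_recl // lerD2l -lee_fin fineK // -sumEFin.
apply: le_trans (nneseries_lim_ge N.+2 T0).
by rewrite [leRHS]big_add1 /= [leRHS]big_add1.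
Qed.

Theorem proposition6p8 (R : realType) (p : nat) (c : R) (d : nat -> R)
    (beta : nat -> 'M[R[i]]_p)
    (c_gt0 : 0 < c)
    (d_gt0 : forall n, (1 <= n)%N -> 0 < d n)
    (beta_selfadjoint : forall n, (1 <= n)%N -> (beta n)^t* = beta n)
    (summable :
      (\sum_(2 <= n <oo)
         (d n * \prod_(1 <= k < n) (1 + c * opnorm (beta k)) ^+ 2)%:E
       < +oo)%E) :
  deficiency_indices (jacobiXb c d beta) p p.
Proof.
have [S S_ub] := weighted_sums_bounded d_gt0 summable.
have A_sa n := diag_selfadjoint c d_gt0 n beta_selfadjoint.
have B_unit := offdiag_unit p c_gt0 d_gt0.
split; apply: deficiency_dim => // f f_sol;
  exact: (solution_l2 c_gt0 d_gt0 f_sol S_ub).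
Qed.
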